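(* Let $k\geq 2$, let $\mathbb F_q$ be the finite field with $q$ elements, let $\beta\in\mathbb Z_{\geq 0}^k$, and let $q^\beta:=(q^{\beta_1},\ldots,q^{\beta_k})\in\mathbb Z_{\geq 1}^k$. The probability that a linear representation $f\in\mathrm{Rep}(Q,\beta)$ over $\mathbb F_q$ is nilpotent is equal to the probability that a set-valued representation $f\in\mathrm{Rep}_{\mathrm{Set}}(Q,q^\beta)$ is eventually constant; precisely, $$\frac{N(\beta)}{|\mathrm{Rep}(Q,\beta)|}=1-\prod_{i=1}^k(1-q^{-\beta_i})=\frac{|\mathcal{EC}(Q,q^\beta)|}{|\mathrm{Rep}_{\mathrm{Set}}(Q,q^\beta)|}.$$
   Context: Indices are taken modulo $k$. $Q$ is the cyclic quiver $1\to 2\to\cdots\to k\to 1$. Linear side: for $\mathbb F_q$-vector spaces $V_1,\ldots,V_k$ with $\dim V_i=\beta_i$, $\mathrm{Rep}(Q,\beta)=\prod_{i=1}^k\mathrm{Hom}_{\mathbb F_q}(V_i,V_{i+1})$; a representation $f=(f_1,\ldots,f_k)$ is nilpotent if for each $i$ and all sufficiently large $\ell$ the composition $f_{i+\ell-1}\circ\cdots\circ f_i$ is zero; $N(\beta)$ is the number of nilpotent representations. Set side: for $\delta\in\mathbb Z_{\geq 1}^k$ and finite sets $X_1,\ldots,X_k$ with $|X_i|=\delta_i$, $\mathrm{Rep}_{\mathrm{Set}}(Q,\delta)=\prod_{i=1}^k\mathrm{Hom}_{\mathrm{Set}}(X_i,X_{i+1})$ (tuples of arbitrary functions $f_i:X_i\to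 X_{i+1}$); such an $f$ is eventually constant if there exists $(c_1,\ldots,c_k)\in\prod_{i=1}^kX_i$ such that for all sufficiently large $\ell$ and all $i$, the composition $f_{i+\ell-1}\circ\cdots\circ f_i$ maps $X_i$ to $\{c_{i+\ell}\}$; $\mathcal{EC}(Q,\delta)$ is the set of eventually constant elements of $\mathrm{Rep}_{\mathrm{Set}}(Q,\delta)$. *)

(* Defs.v *)
From mathcomp Require Import all_boot all_order all_algebra all_field.
From mathcomp Require Import boolp.

Set Implicit Arguments.
Unset Strict Implicit.
Unset Printing Implicit Defensive.

Import GRing.Theory.
Local Open Scope ring_scope.

(* The vertices of the cyclic quiver are the elements of 'I_k; the arrow at i
   goes from i to ordS i, so the vertex i + l is iter l (@ordS k) i. *)

(* finvect_type only equips the vector space of linear maps with its finType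
   structure over the finite field F. *)
Definition Rep (k : nat) (F : finFieldType) (V : 'I_k -> vectType F) : finType :=
  {dffun forall i : 'I_k, finvect_type 'Hom(V i, V (ordS i))}.

Definition RepSet (k : nat) (X : 'I_k -> finType) : finType :=
  {dffun forall i : 'I_k, {ffun X i -> X (ordS i)}}.

(* f_(i + l - 1) \o ... \o f_i *)
Fixpoint lin_path (k : nat) (F : finFieldType) (V : 'I_k -> vectType F)
    (f : Rep V) (i : 'I_k) (l : nat) : 'Hom(V i, V (iter l (@ordS k) i)) :=
  match l return 'Hom(V i, V (iter l (@ordS k) i)) with
  | 0 => \1%VF
  | l'.+1 => (f (iter l' (@ordS k) i) \o lin_path f i l')%VF
  end.

Fixpoint set_path (k : nat) (X : 'I_k -> finType) (f : RepSet X) (i : 'I_k)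
    (l : nat) (x : X i) : X (iter l (@ordS k) i) :=
  match l return X (iter l (@ordS k) i) with
  | 0 => x
  | l'.+1 => f (iter l' (@ordS k) i) (set_path f l' x)
  end.

Definition nilpotent_rep (k : nat) (F : finFieldType) (V : 'I_k -> vectType F)
    (f : Rep V) : Prop :=
  forall i : 'I_k, exists L : nat, forall l : nat, (L <= l)%N ->
    lin_path f i l = 0.

Definition eventually_constant (k : nat) (X : 'I_k -> finType)
    (f : RepSet X) : Prop :=
  exists c : forall i : 'I_k, X i, exists L : nat,
    forall l : nat, (L <= l)%N -> forall (i : 'I_k) (x : X i),
      set_path f l x = c (iter l (@ordS k) i).

Definition NilRep (k : nat) (F : finFieldType) (V : 'I_k -> vectType F) :
  {set Rep V} := [set f | `[< nilpotent_rep f >]].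

Definition EC (k : nat) (X : 'I_k -> finType) : {set RepSet X} :=
  [set f | `[< eventually_constant f >]].

(* Main.v *)
(* Both probabilities reduce to one arrow.  Fix all arrows except the one out of
   a vertex, [f : V -> W], and let [g : W -> V] be the composite of the others.
   Then [f] completes a nilpotent representation iff [g \o f] is nilpotent, and
   for fixed [g] this has probability [P(g w = 0)] for a uniform [w : W].  In the
   set case, [g \o f] is eventually constant with probability [P(g w = g w')]
   for uniform independent [w, w'].  Following [w] (or the pair [w, w']) through
   the uniform arrows composing [g] then gives the product formula.

   Both one-arrow statements come from revealing [f] along orbits of [h = g \o f].
   Let [A] be a subspace (resp. subset) that is already known to be attracted to
   the target.  Reveal [v, h v, h^2 v, ...] and let [B] be the span of [A] and the
   orbit before its current tip, [B'] its span with the tip.  The next point [g w]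
   lies in [A] (then [B'] replaces [A]), in [B'] but not in [A] (then [h] does not
   collapse), or outside [B'] (then the orbit grows).  The success probability is
   [p A := P(g w \in A)] in all states, because
   [p A * p B' + 0 + (1 - p B') * p A = p A]. *)
From HB Require Import structures.
Require Import Defs.
From mathcomp Require Import all_boot all_order all_algebra all_field.
From mathcomp Require Import boolp zify ring.

Set Implicit Arguments.
Unset Strict Implicit.
Unset Printing Implicit Defensive.

Import GRing.Theory.

(** * Revealing a random map along an orbit *)

Section Exploration.

Variables (T W Phi : finType) (ev : Phi -> T -> W) (g : W -> T).
(* [closed] is instantiated by the subspaces of a vector space, or by all
   subsets of a set. *)
Variables (closed : pred {set T}) (A0 : {set T}).

Definition hop (f : Phi) (x : T) : T := g (ev f x).
Definition attracts (f : Phi) (x : T) : Prop := exists l, iter l (hop f) x \in A0.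
Definition basin (f : Phi) : {set T} := [set x | `[< attracts f x >]].
Definition hull (B : {set T}) : {set T} := \bigcap_(C | closed C && (B \subset C)) C.
Definition orbit_hull (f : Phi) (A : {set T}) (v : T) (j : nat) : {set T} :=
  hull (A :|: [set iter i (hop f) v | i : 'I_j]).
(** Counting inside this set stands for conditioning on the values revealed so far. *)
Definition agree (B : {set T}) (f0 : Phi) : {set Phi} :=
  [set f | [forall x in B, ev f x == ev f0 x]].

Hypothesis closedT : closed setT.
Hypothesis closedI : forall C D, closed C -> closed D -> closed (C :&: D).
Hypothesis closed_eqz : forall f f', closed [set x | ev f x == ev f' x].
Hypothesis closed_pre : forall f C, closed C -> closed [set x | hop f x \in C].
Hypothesis closed_basin : forall f, closed (basin f).
(** Resampling: the value at a point outside a closed [B] can be changed reversibly without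
    disturbing [B], so given the values on [B] it is uniform on [W]. *)
Hypothesis put_ex : forall B x, closed B -> x \notin B ->
  exists put : Phi -> W -> Phi,
    [/\ forall f w, {in B, ev (put f w) =1 ev f},
        forall f w, ev (put f w) x = w
      & forall f w, put (put f w) (ev f x) = f].
(** If every point is attracted, an orbit can re-enter the hull of [A] and its own past only through
    [A]. *)
Hypothesis hull_return : forall f A v j,
  closed A -> A0 \subset A -> {in A, forall x, hop f x \in A} ->
  (forall x, attracts f x) ->
  iter j (hop f) v \in orbit_hull f A v j -> iter j (hop f) v \in A.

Implicit Types (A B C : {set T}) (f : Phi) (v x : T) (w : W) (m j : nat).

Lemma closed_hull B : closed (hull B).
Proof.
rewrite /hull; apply: (big_ind (fun C => closed C)) => //.
by move=> C /andP[].
Qed.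

Lemma sub_hull B : B \subset hull B.
Proof. by apply/bigcapsP => C /andP[]. Qed.

Lemma hull_min B C : closed C -> B \subset C -> hull B \subset C.
Proof. by move=> cC sBC; apply: bigcap_inf; rewrite cC. Qed.

Lemma orbit_hull_min f A v j C : closed C -> A \subset C ->
  (forall i, i < j -> iter i (hop f) v \in C) -> orbit_hull f A v j \subset C.
Proof.
move=> cC sAC oC; apply: hull_min => //; rewrite subUset sAC /=.
by apply/subsetP => x /imsetP[i _ ->]; apply: oC.
Qed.

Lemma sub_orbit_hull f A v j : A \subset orbit_hull f A v j.
Proof. exact: subset_trans (subsetUl _ _) (sub_hull _). Qed.

Lemma mem_orbit_hull f A v j i : i < j -> iter i (hop f) v \in orbit_hull f A v j.
Proof.
move=> ij; apply: (subsetP (sub_hull _)); rewrite inE; apply/orP; right.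
by apply/imsetP; exists (Ordinal ij).
Qed.

Lemma orbit_hull0 f A v : closed A -> orbit_hull f A v 0 = A.
Proof.
move=> cA; apply/eqP; rewrite eqEsubset sub_orbit_hull andbT.
exact: orbit_hull_min.
Qed.

Lemma orbit_hullS f A v j :
  orbit_hull f A v j \subset orbit_hull f A v j.+1.
Proof.
apply: orbit_hull_min; first exact: closed_hull.
  exact: sub_orbit_hull.
by move=> i ij; apply: mem_orbit_hull; apply: ltnW.
Qed.

Lemma eq_orbit_hull f f' A v j :
  (forall i, i < j -> iter i (hop f) v = iter i (hop f') v) ->
  orbit_hull f A v j = orbit_hull f' A v j.
Proof.
move=> e; congr (hull (_ :|: _)); apply/setP => x; apply/imsetP/imsetP => -[i _ ->];
  by exists i => //; rewrite e.
Qed.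

Lemma agreeP (B : {set T}) f0 f : reflect {in B, ev f =1 ev f0} (f \in agree B f0).
Proof.
rewrite inE; apply: (iffP forall_inP) => H x xB; last by apply/eqP; exact: H.
by apply/eqP; apply: H.
Qed.

Lemma iter_agree (B : {set T}) f f' v i : {in B, ev f =1 ev f'} ->
  (forall i', i' < i -> iter i' (hop f') v \in B) ->
  iter i (hop f) v = iter i (hop f') v.
Proof.
move=> e; elim: i => //= i IH H.
rewrite IH; last by move=> i' i'i; apply: H; apply: ltnW.
by rewrite /hop e //; apply: H.
Qed.

Lemma iter_stable f (A : {set T}) x l : {in A, forall x, hop f x \in A} -> x \in A ->
  iter l (hop f) x \in A.
Proof. by move=> st xA; elim: l => //= l IH; apply: st. Qed.

Definition nil_agree B f0 := [set f in agree B f0 | `[< forall x, attracts f x >]].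

(** The region already known to be attracted; being invariant, it is certified by the values of [f0]
    on [A] alone. *)
Definition trap A f0 := [/\ closed A, A0 \subset A,
  {in A, forall x, hop f0 x \in A} & A \subset basin f0].

(** The conditional success probability is [P(g w \in A)], cross-multiplied to stay in [nat] and to
    cover an empty [W]. *)
Definition proportion B A f0 :=
  #|nil_agree B f0| * #|W| = #|agree B f0| * #|[set w | g w \in A]|.

Lemma proportion_full f0 : trap setT f0 -> proportion setT setT f0.
Proof.
case=> _ _ _ sTf; have nilE f : f \in agree setT f0 -> forall x, attracts f x.
  move=> /agreeP e x; have := subsetP sTf x (in_setT _); rewrite inE => /asboolP[l].
  by exists l; rewrite (iter_agree e).
rewrite /proportion; congr (_ * _).
  by apply: eq_card => f; rewrite inE andb_idr // => /nilE H; apply/asboolP.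
by rewrite -cardsT; apply: eq_card => w; rewrite !inE.
Qed.

(** Total probability over the value [w] at [x]. Since [B'] lies in every closed set containing [B]
    and [x], fixing [f] on [B'] amounts to fixing it on [B] and at [x]. *)
Lemma reveal B B' x f0 : closed B -> x \notin B -> B \subset B' -> x \in B' ->
    (forall C, closed C -> B \subset C -> x \in C -> B' \subset C) ->
  exists ext : W -> Phi,
    [/\ forall w, {in B, ev (ext w) =1 ev f0},
        forall w, ev (ext w) x = w,
        forall w, #|agree B f0| = #|W| * #|agree B' (ext w)|
      & #|nil_agree B f0| = \sum_w #|nil_agree B' (ext w)|].
Proof.
move=> cB xB sBB' xB' minB'; have [put [putB putx putK]] := put_ex cB xB.
have agreeE f w : (f \in agree B' (put f0 w)) = (f \in agree B f0) && (ev f x == w).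
  apply/agreeP/andP => [e|[/agreeP e /eqP fx]].
    split; last by rewrite e // putx.
    by apply/agreeP => y yB; rewrite e ?putB //; apply: (subsetP sBB').
  have : B' \subset [set y | ev f y == ev (put f0 w) y].
    apply: minB'; first exact: closed_eqz.
      by apply/subsetP => y yB; rewrite inE e // putB.
    by rewrite inE fx putx.
  by move/subsetP => H y /H; rewrite inE => /eqP.
have splitE (P : pred Phi) :
    #|[set f in agree B f0 | P f]| = \sum_w #|[set f in agree B' (put f0 w) | P f]|.
  rewrite -sum1_card (partition_big (ev^~ x) xpredT) //=; apply: eq_bigr => w _.
  by rewrite -sum1_card; apply: eq_bigl => f; rewrite in_set [RHS]in_set agreeE andbAC.
(* [put^~ w'] embeds the piece over [w] into the piece over [w']; by symmetry all pieces have the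
   same size. *)
have le_agree w w' : #|agree B' (put f0 w)| <= #|agree B' (put f0 w')|.
  rewrite -(card_in_imset (f := put^~ w') (D := agree B' (put f0 w))).
    apply: subset_leq_card; apply/subsetP => _ /imsetP[f fw ->].
    move: fw; rewrite !agreeE putx eqxx andbT => /andP[/agreeP e _].
    by apply/agreeP => y yB; rewrite putB // e.
  move=> f f'; rewrite !agreeE => /andP[_ /eqP fx] /andP[_ /eqP f'x] e.
  by rewrite -(putK f w') e fx -f'x putK.
exists (put f0); split=> //; last exact: splitE.
move=> w; have := splitE xpredT; rewrite /= => H.
transitivity (\sum_(w' : W) #|agree B' (put f0 w)|); last by rewrite sum_nat_const.
transitivity #|[set f in agree B f0 | true]|.
  by apply: eq_card => f; rewrite inE andbT.
rewrite H; apply: eq_bigr => w' _.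
transitivity #|agree B' (put f0 w')|; first by apply: eq_card => f; rewrite inE andbT.
by apply/eqP; rewrite eqn_leq !le_agree.
Qed.

Lemma trap_agree A f0 f : trap A f0 -> {in A, ev f =1 ev f0} -> trap A f.
Proof.
move=> [cA sA st nA] e; split=> //; first by move=> x xA; rewrite /hop e //; apply: st.
apply/subsetP => x xA; have := subsetP nA x xA; rewrite !inE => /asboolP[l hl].
apply/asboolP; exists l; rewrite (iter_agree e) // => i' _.
exact: iter_stable.
Qed.

Definition free_orbit f A v j := forall i, i <= j -> iter i (hop f) v \notin orbit_hull f A v i.

Definition trap_claim m :=
  forall A f0, trap A f0 -> #|~: A| <= m -> proportion A A f0.

(** Values are revealed only before the tip, but the measure [m] counts what is outside the hull
    with the tip. So starting an orbit already lowers the measure below that of its trap. *)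
Definition orbit_claim m := forall A f0 v j, trap A f0 -> free_orbit f0 A v j ->
  #|~: orbit_hull f0 A v j.+1| <= m -> proportion (orbit_hull f0 A v j) A f0.

(** Any [v] outside [A] starts a fresh orbit, whose hull of length 0 is [A] itself. If there is no
    such [v], success is certain on both sides. *)
Lemma trap_claim_step m : (forall m', m' < m -> orbit_claim m') -> trap_claim m.
Proof.
move=> IH A f0 tA cardA; have [cA sA st nA] := tA.
have [|/subsetPn[v _ vA]] := boolP ([set: T] \subset A); last first.
  have h0 := orbit_hull0 f0 v cA; rewrite /proportion -{1 2}h0.
  have lt : #|~: orbit_hull f0 A v 1| < m.
    apply: leq_trans cardA; apply: proper_card; rewrite properC -{1}h0.
    apply/properP; split; first exact: orbit_hullS.
    by exists v; [exact: (@mem_orbit_hull f0 A v 1 0)|rewrite h0].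
  by apply: (IH _ lt) => // -[|//] _ /=; rewrite h0.
rewrite subTset => /eqP AT; move: tA; rewrite AT.
exact: proportion_full.
Qed.

Lemma trap_grow A f v j : trap A f -> iter j (hop f) v \in A -> trap (orbit_hull f A v j) f.
Proof.
move=> [cA sA st nA] vjA; have cB : closed (orbit_hull f A v j) by apply: closed_hull.
have sAB := sub_orbit_hull f A v j; split=> //.
- exact: subset_trans sAB.
- have : orbit_hull f A v j \subset [set x | hop f x \in orbit_hull f A v j].
    apply: orbit_hull_min; first exact: closed_pre.
      by apply/subsetP => x xA; rewrite inE; apply/(subsetP sAB)/st.
    move=> i ij; rewrite inE -iterS; case: (ltngtP i.+1 j) ij => // [ij _|-> _].
      exact: mem_orbit_hull.
    exact: (subsetP sAB).
  by move/subsetP => H x /H; rewrite inE.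
- apply: orbit_hull_min => // i ij; rewrite inE.
  have := subsetP nA _ vjA; rewrite inE => /asboolP[l hl]; apply/asboolP.
  by exists (l + (j - i)); rewrite -iterD -addnA subnK ?iterD // ltnW.
Qed.

(** The value [w] at the tip [x] is revealed; [fall], [loop] and [go] are the three positions of
    [g w]. [fall] continues from the larger trap [B'] within the bound [m], [go] lowers the
    bound. *)
Lemma orbit_claim_step m : trap_claim m -> (forall m', m' < m -> orbit_claim m') ->
  orbit_claim m.
Proof.
move=> IHt IHo A f0 v j tA free cardB; have [cA sA st nA] := tA.
set B := orbit_hull f0 A v j; set B' := orbit_hull f0 A v j.+1 in cardB *.
set x := iter j (hop f0) v.
have xB : x \notin B by apply: free.
have sBB' : B \subset B' by apply: orbit_hullS.
have xB' : x \in B' by apply: mem_orbit_hull.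
have sAB : A \subset B by apply: sub_orbit_hull.
have cB' : closed B' by apply: closed_hull.
have minB' C : closed C -> B \subset C -> x \in C -> B' \subset C.
  move=> cC sBC xC; apply: orbit_hull_min => //; first exact: subset_trans sBC.
  move=> i; rewrite ltnS leq_eqVlt => /orP[/eqP-> //|ij].
  by apply: (subsetP sBC); apply: mem_orbit_hull.
have [ext [extB extx cardE nilE]] := reveal f0 (closed_hull _) xB sBB' xB' minB'.
have itE w i : i <= j -> iter i (hop (ext w)) v = iter i (hop f0) v.
  move=> ij; apply: (iter_agree (extB w)) => i' i'i; apply: mem_orbit_hull.
  exact: leq_trans ij.
have itS w : iter j.+1 (hop (ext w)) v = g w by rewrite /= itE // /hop extx.
have hullE w i : i <= j.+1 -> orbit_hull (ext w) A v i = orbit_hull f0 A v i.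
  by move=> ij; apply: eq_orbit_hull => i' i'i; apply: itE; rewrite -ltnS (leq_trans i'i).
have tw w : trap A (ext w).
  by apply: trap_agree tA _ => y yA; apply: extB; apply: (subsetP sAB).
have sAB' := subset_trans sAB sBB'.
have fall w : g w \in A ->
    #|nil_agree B' (ext w)| * #|W| = #|agree B' (ext w)| * #|[set w | g w \in B']|.
  move=> gA; have := @trap_grow A (ext w) v j.+1 (tw w).
  by rewrite itS hullE // => /(_ gA) tB'; apply: IHt.
have loop w : g w \in B' -> g w \notin A -> #|nil_agree B' (ext w)| = 0.
  move=> gB' gA; apply: eq_card0 => f; rewrite inE; apply/negP => /andP[/agreeP e /asboolP nf].
  have it i : i <= j.+1 -> iter i (hop f) v = iter i (hop (ext w)) v.
    move=> ij; apply: (iter_agree e) => i' i'i; rewrite /B' -(hullE w j.+1 (leqnn _)).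
    by apply: mem_orbit_hull; apply: leq_trans ij.
  (* For a successful [f], [hull_return] would force [g w] into [A]. *)
  case/negP: gA; rewrite -itS -it //; apply: hull_return => //.
    have [_ _ stf _] := @trap_agree A (ext w) f (tw w)
      (fun y yA => e y (subsetP sAB' y yA)).
    exact: stf.
  rewrite it // itS (eq_orbit_hull A (f' := ext w)) ?hullE // => i ij.
  by apply: it; apply: ltnW.
have go w : g w \notin B' ->
    #|nil_agree B' (ext w)| * #|W| = #|agree B' (ext w)| * #|[set w | g w \in A]|.
  move=> gB'; have lt : #|~: orbit_hull (ext w) A v j.+2| < m.
    apply: leq_trans cardB; apply: proper_card; rewrite properC.
    apply/properP; rewrite /B' -(hullE w) //; split; first exact: orbit_hullS.
    exists (g w); last by rewrite hullE.
    by rewrite -itS; apply: mem_orbit_hull.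
  have := IHo _ lt A (ext w) v j.+1 (tw w) _ (leqnn _); rewrite /proportion hullE //.
  apply=> i; rewrite leq_eqVlt => /orP[/eqP->|ij]; first by rewrite itS hullE.
  by rewrite itE // hullE; [apply: free|apply: ltnW].
(* With [W] empty both sides vanish; otherwise [w0] serves to name the common size [S] of the
   pieces. *)
have [w0 _|W0] := pickP W; last first.
  have W0' : #|W| = 0 by apply: eq_card0.
  rewrite /proportion W0' muln0 [X in _ * X]eq_card0 ?muln0 // => w.
  by have := W0 w.
pose S := #|agree B' (ext w0)|.
have SE w : #|agree B' (ext w)| = S.
  have Wgt0 : 0 < #|W| by apply/card_gt0P; exists w0.
  by apply/eqP; rewrite -(eqn_pmul2l Wgt0) -!cardE.
rewrite /proportion nilE big_distrl /= (cardE w0) -/S.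
rewrite (bigID (fun w => g w \in A)) /=.
rewrite (eq_bigr (fun=> S * #|[set w | g w \in B']|)); last first.
  by move=> w /fall->; rewrite SE.
rewrite [X in _ + X](bigID (fun w => g w \in B')) /=.
rewrite [X in _ + (X + _)]big1; last by move=> w /andP[gA gB']; rewrite loop.
rewrite [X in _ + (_ + X)](eq_bigr (fun=> S * #|[set w | g w \in A]|)); last first.
  by move=> w /andP[_ /go->]; rewrite SE.
rewrite !sum_nat_const add0n.
rewrite (_ : #|[pred w | g w \in A]| = #|[set w | g w \in A]|); last first.
  by apply: eq_card => w; rewrite inE.
rewrite (_ : #|[pred w | _ & _]| = #|~: [set w | g w \in B']|); last first.
  apply: eq_card => w; rewrite !inE andb_idl //.
  by apply: contra => /(subsetP sAB').
(* Splitting [#|W|] by membership of [g w] in [B'] leaves [p A * p B' + (1 - p B') * p A = p A]. *)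
have := cardsC [set w | g w \in B']; set a := #|_|; set b := #|_|; set c := #|_|.
by move=> <-; ring.
Qed.

Theorem card_nil_agree A f0 : trap A f0 ->
  #|nil_agree A f0| * #|W| = #|agree A f0| * #|[set w | g w \in A]|.
Proof.
(* Orbit claims below [m] give the trap claim at [m], which in turn gives the orbit claim at [m]. *)
move=> tA; have claims m : trap_claim m /\ orbit_claim m.
  elim/ltn_ind: m => m IH; have IHo m' (lt : m' < m) := (IH m' lt).2.
  have IHt := trap_claim_step IHo; split=> //.
  exact: orbit_claim_step.
exact: ((claims _).1 A f0 tA (leqnn _)).
Qed.

End Exploration.

(** The clause [h r = r] rules out cyclic permutations, where every orbit visits every point. *)
Definition collapses (T : Type) (h : T -> T) (r : T) : Prop :=
  h r = r /\ forall x, exists l, iter l h x = r.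

Lemma iter_fixpoint (T : Type) (h : T -> T) (r : T) l : h r = r -> iter l h r = r.
Proof. by move=> hr; elim: l => //= l ->. Qed.

Lemma collapses_uniq (T : Type) (h : T -> T) (r s : T) :
  collapses h r -> collapses h s -> r = s.
Proof. by move=> [hr _] [_ /(_ r)[l]]; rewrite iter_fixpoint. Qed.

(** * Counting by resampling one coordinate *)

Section Lens.

Variables (S W : finType) (get : S -> W) (put : S -> W -> S).
Hypothesis get_put : forall s w, get (put s w) = w.
Hypothesis put_get : forall s w, put (put s w) (get s) = s.

(* The swap (s, w) |-> (put s w, get s) is an involution of S * W. *)
Lemma sum_put (phi : S -> nat) :
  \sum_s \sum_w phi (put s w) = (\sum_s phi s) * #|W|.
Proof.
rewrite pair_bigA /= (reindex (fun p : S * W => (put p.1 p.2, get p.1))) /=.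
  under eq_bigr do rewrite put_get.
  rewrite big_distrl /= -(pair_bigA _ (fun s _ => phi s)) /=.
  by apply: eq_bigr => s _; rewrite sum_nat_const mulnC.
exists (fun p : S * W => (put p.1 p.2, get p.1)) => -[s w] _ /=;
  by rewrite put_get get_put.
Qed.

Lemma card_get (D : pred W) : #|[set s | D (get s)]| * #|W| = #|S| * #|[set w | D w]|.
Proof.
have -> : #|[set s | D (get s)]| = \sum_s (D (get s) : nat).
  by rewrite -sum1_card big_mkcond; apply: eq_bigr => s _; rewrite inE; case: ifP.
rewrite -sum_put -sum_nat_const; apply: eq_bigr => s _.
rewrite -sum1_card [RHS]big_mkcond; apply: eq_bigr => w _.
by rewrite get_put inE; case: ifP.
Qed.

End Lens.

Lemma sum_card_set (T S : finType) (P : T -> pred S) :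
  \sum_t #|[set s | P t s]| = \sum_s #|[set t | P t s]|.
Proof.
transitivity (\sum_t \sum_s (P t s : nat)).
  apply: eq_bigr => t _; rewrite -sum1_card big_mkcond; apply: eq_bigr => s _.
  by rewrite inE; case: ifP.
rewrite exchange_big; apply: eq_bigr => s _; rewrite -sum1_card [RHS]big_mkcond.
by apply: eq_bigr => t _; rewrite inE; case: ifP.
Qed.

Lemma card_set_sum (S : finType) (P : pred S) : #|[set s | P s]| = \sum_s (P s : nat).
Proof.
by rewrite -sum1_card big_mkcond; apply: eq_bigr => s _; rewrite inE; case: ifP.
Qed.

(** * One random arrow *)

Section SetMaps.

Variables (X Y : finType).

Definition ffun_put (x : X) (f : {ffun X -> Y}) (y : Y) : {ffun X -> Y} :=
  [ffun z => if z == x then y else f z].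

Lemma ffun_get_put x f y : ffun_put x f y x = y.
Proof. by rewrite ffunE eqxx. Qed.

Lemma ffun_put_out x f y z : z != x -> ffun_put x f y z = f z.
Proof. by rewrite ffunE => /negbTE->. Qed.

Lemma ffun_put_get x f y : ffun_put x (ffun_put x f y) (f x) = f.
Proof. by apply/ffunP => z; rewrite ffunE; case: eqP => [->|/eqP/ffun_put_out->]. Qed.

Variable g : Y -> X.

(** The square comes from two conditions: [w = f r] must satisfy [g w = r] for [r] to be fixed, and
    given this value [card_nil_agree] with target and trap [[set r]] contributes the second
    factor. *)
Lemma card_collapsing_to (r : X) :
  #|[set f : {ffun X -> Y} | `[< collapses (fun x => g (f x)) r >]]| * #|Y| ^ 2 =
  #|{ffun X -> Y}| * #|[set w | g w == r]| ^ 2.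
Proof.
pose nil := nil_agree (fun (f : {ffun X -> Y}) x => f x) g [set r] [set r].
pose fib := #|[set w | g w == r]|.
have fibE : #|[set w | g w \in [set r]]| = fib by apply: eq_card => w; rewrite !inE.
have step w : g w = r -> #|nil [ffun=> w]| * #|Y| ^ 2 = #|{ffun X -> Y}| * fib.
  move=> gw; rewrite expnS expn1 mulnA /nil.
  rewrite (@card_nil_agree X Y {ffun X -> Y} (fun f x => f x) g predT) //; last 3 first.
  - move=> B x _ xB; exists (ffun_put x); split=> [f y z zB|f y|f y].
    + by rewrite ffun_put_out //; apply: contraNneq xB => <-.
    + exact: ffun_get_put.
    + exact: ffun_put_get.
  (* [hull_return] for subsets: a point equal to an earlier orbit point is periodic, so it recurs
     after the orbit has entered [A] for good. *)
  - move=> f A v j _ s0A stA /(_ v)[l].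
    set h := hop _ _ _ => hl.
    have tail n : l <= n -> iter n h v \in A.
      move=> ln; rewrite -(subnK ln) iterD; apply: iter_stable => //.
      by apply: (subsetP s0A).
    have sub : orbit_hull (fun (f : {ffun X -> Y}) x => f x) g predT f A v j
        \subset A :|: [set iter i h v | i : 'I_j].
      apply: orbit_hull_min => //; first exact: subsetUl.
      by move=> i ij; apply/setUP; right; apply/imsetP; exists (Ordinal ij).
    move/(subsetP sub) => /setUP[//|/imsetP[[i ij] _ /= e]].
    have per : iter (j - i) h (iter j h v) = iter j h v.
      by rewrite {1}e -iterD subnK // ltnW.
    rewrite -(iter_fixpoint l per) -iterM -iterD; apply: tail.
    by rewrite (leq_trans _ (leq_addr _ _)) // leq_pmulr // subn_gt0.
  - split=> //; first by move=> x; rewrite !inE /hop => /eqP->; rewrite ffunE gw.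
    by apply/subsetP => x xr; rewrite inE; apply/asboolP; exists 0.
  rewrite fibE mulnAC; congr (_ * _).
  have := card_get (ffun_get_put r) (ffun_put_get r) (pred1 w).
  rewrite (_ : [set _ | _] = [set w]) ?cards1 ?muln1; last by apply/setP => y; rewrite !inE.
  move=> <-; congr (_ * _); apply: eq_card => f; rewrite !inE /=.
  apply/forall_inP/eqP => [/(_ r)|fw x]; first by rewrite inE eqxx ffunE => /(_ isT)/eqP.
  by rewrite inE ffunE => /eqP->; rewrite fw.
have agree_fix w f : g w = r ->
    (f \in nil [ffun=> w]) = `[< collapses (fun x => g (f x)) r >] && (f r == w).
  move=> gw; rewrite in_set andbC.
  have agE : (f \in agree (fun (f : {ffun X -> Y}) x => f x) [set r] [ffun=> w]) = (f r == w).
    rewrite inE; apply/forall_inP/eqP => [/(_ r)|fw x].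
      by rewrite inE eqxx ffunE => /(_ isT)/eqP.
    by rewrite inE ffunE => /eqP->; rewrite fw.
  rewrite agE; case: eqP => [fr|]; rewrite ?andbT ?andbF //.
  apply/asboolP/asboolP => [nf|[_ nf] x].
    by split=> [|x]; [rewrite fr | have [l] := nf x; rewrite inE => /eqP <-; exists l].
  by have [l <-] := nf x; exists l; rewrite inE.
have -> : #|[set f : {ffun X -> Y} | `[< collapses (fun x => g (f x)) r >]]| =
    \sum_(w | g w == r) #|nil [ffun=> w]|.
  rewrite -sum1_card (partition_big (fun f : {ffun X -> Y} => f r) (fun w => g w == r)) /=.
    apply: eq_bigr => w /eqP gw; rewrite -sum1_card; apply: eq_bigl => f.
    by rewrite agree_fix // inE.
  by move=> f; rewrite inE => /asboolP[/eqP].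
rewrite big_distrl /= (eq_bigr (fun=> #|{ffun X -> Y}| * fib)); last by move=> w /eqP/step.
rewrite sum_nat_const expnS expn1 mulnCA; congr (_ * (_ * _)).
by apply: eq_card => w; rewrite inE.
Qed.

(** The point [r] is unique, so the counts add up over [r], and the squared fibre sizes of [g] sum
    to the number of pairs with equal image. *)
Lemma card_collapsing_ffun :
  #|[set f : {ffun X -> Y} | `[< exists r, collapses (fun x => g (f x)) r >]]| * #|Y| ^ 2 =
  #|{ffun X -> Y}| * #|[set p : Y * Y | g p.1 == g p.2]|.
Proof.
have -> : #|[set f : {ffun X -> Y} | `[< exists r, collapses (fun x => g (f x)) r >]]| =
    \sum_r #|[set f : {ffun X -> Y} | `[< collapses (fun x => g (f x)) r >]]|.
  rewrite sum_card_set -sum1_card big_mkcond; apply: eq_bigr => f _; rewrite inE.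
  case: asboolP => [[r cr]|nf]; last first.
    by apply/esym/eq_card0 => r; rewrite inE; apply/asboolP => cr; apply: nf; exists r.
  apply/esym/eqP/cards1P; exists r; apply/setP => s; rewrite !inE.
  by apply/asboolP/eqP => [cs|-> //]; apply: collapses_uniq cs cr.
rewrite big_distrl /= (eq_bigr _ (fun r _ => card_collapsing_to r)) -big_distrr /=.
congr (_ * _); rewrite -[RHS]sum1_card (partition_big (fun p => g p.1) xpredT) //=.
apply: eq_bigr => r _; rewrite expnS expn1 -cardsX -sum1_card; apply: eq_bigl => -[a b].
rewrite !inE /=; apply/andP/andP => -[/eqP ga /eqP gb]; split; apply/eqP; congruence.
Qed.

End SetMaps.

(** * Going around the cycle *)

Import Num.Theory.

Lemma val_iter_ordS n (i : 'I_n.+1) l : iter l (@ordS n.+1) i = (i + l) %% n.+1 :> nat.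
Proof.
elim: l => [|l IH]; first by rewrite addn0 modn_small.
by rewrite iterS /= IH -addn1 modnDml addn1 addnS.
Qed.

Lemma iter_ordS_inj n (i : 'I_n.+1) l m : l <= n -> m <= n ->
  iter l (@ordS n.+1) i = iter m (@ordS n.+1) i -> l = m.
Proof.
move=> ln mn /(congr1 (@nat_of_ord _)); rewrite !val_iter_ordS => /eqP.
by rewrite eqn_modDl !modn_small ?ltnS // => /eqP.
Qed.

Lemma iter_ordS_cycle n (i : 'I_n.+1) : iter n (@ordS n.+1) (ordS i) = i.
Proof.
by rewrite -iterSr; apply: ord_inj; rewrite val_iter_ordS modnDr modn_small.
Qed.

Section DffunPut.

Variables (I : finType) (U : I -> finType) (i : I).

Definition dffun_put (f : {dffun forall j, U j}) (u : U i) : {dffun forall j, U j} :=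
  finfun (dfwith f u).

Lemma dffun_get_put f u : dffun_put f u i = u.
Proof. by rewrite ffunE dfwith_in. Qed.

Lemma dffun_put_out f u j : j != i -> dffun_put f u j = f j.
Proof. by rewrite ffunE eq_sym => ij; rewrite dfwith_out. Qed.

Lemma dffun_put_get f u : dffun_put (dffun_put f u) (f i) = f.
Proof.
apply/ffunP => j; have [->|ji] := eqVneq j i; first exact: dffun_get_put.
by rewrite !dffun_put_out.
Qed.

End DffunPut.

(** * Survival of a state along the arrows of the cycle *)

Section CyclicPath.

(** Serves both sides at once: [E] marks a collapsed state, either the zero vector or a pair of
    equal points, and [1 / c i] is the probability of [E] at vertex [i]. *)
Variables (n : nat) (Z M : 'I_n.+1 -> finType).
Variable act : forall i, M i -> Z i -> Z (ordS i).
Variable E : forall i, pred (Z i).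
Variable c : 'I_n.+1 -> nat.

Local Notation R := {dffun forall i, M i}.

Fixpoint act_path (f : R) i (l : nat) (z : Z i) : Z (iter l (@ordS n.+1) i) :=
  match l return Z (iter l (@ordS n.+1) i) with
  | 0 => z
  | l'.+1 => act (f (iter l' (@ordS n.+1) i)) (act_path f l' z)
  end.

Lemma act_path_put (f : R) i j (u : M j) l (z : Z i) :
  (forall m, m < l -> iter m (@ordS n.+1) i != j) ->
  act_path (dffun_put f u) l z = act_path f l z.
Proof.
elim: l => //= l IH ij; rewrite IH => [|m ml]; last by apply: ij; apply: ltnW.
by rewrite dffun_put_out // ij.
Qed.

Hypothesis actE : forall i (u : M i) z, E z -> E (act u z).
Hypothesis card_act : forall i (z : Z i), ~~ E z ->
  #|[set u | E (act u z)]| * c (ordS i) = #|M i|.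
Hypothesis card_E : forall i, #|[set z : Z i | E z]| * c i = #|Z i|.
Hypothesis M_gt0 : forall i, 0 < #|M i|.
Hypothesis Z_gt0 : forall i, 0 < #|Z i|.

Definition misses i l := \sum_(f : R) #|[set z : Z i | ~~ E (act_path f l z)]|.

Lemma card_setC_mul (S : finType) (P : pred S) d : #|[set s | P s]| * d = #|S| ->
  #|[set s | ~~ P s]| * d = #|S| * d.-1.
Proof.
move=> H; have -> : [set s | ~~ P s] = ~: [set s | P s] by apply/setP => s; rewrite !inE.
have := cardsC [set s | P s]; move: H; case: d => [|d]; first by rewrite muln0 !muln0.
set a := #|_|; set b := #|_|; rewrite /= => <- H; move: H; rewrite -/b; nia.
Qed.

Lemma misses0 i : misses i 0 * c i = #|{: R}| * #|Z i| * (c i).-1.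
Proof.
by rewrite /misses /= sum_nat_const -!mulnA; congr (_ * _); apply: card_setC_mul.
Qed.

Lemma missesS i l : l < n -> misses i l.+1 * c (iter l.+1 (@ordS n.+1) i) =
  misses i l * (c (iter l.+1 (@ordS n.+1) i)).-1.
Proof.
move=> ln; set j := iter l (@ordS n.+1) i; rewrite [iter l.+1 _ _]/(ordS j).
apply/eqP; rewrite -(eqn_pmul2l (M_gt0 j)); apply/eqP; rewrite mulnA.
rewrite [#|M j| * misses _ _]mulnC /misses.
rewrite -(sum_put (@dffun_get_put _ M j) (@dffun_put_get _ M j)) mulnA [_ * \sum__ _]mulnC -mulnA.
rewrite !big_distrl /=; apply: eq_bigr => f _.
transitivity ((\sum_(u : M j) #|[set z : Z i | ~~ E (act u (act_path f l z))]|) * c (ordS j)).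
  congr (_ * _); apply: eq_bigr => u _; apply: eq_card => z; rewrite !inE /=.
  rewrite dffun_get_put act_path_put // => m ml; apply/eqP => /iter_ordS_inj.
  by move=> /(_ (leq_trans (ltnW ml) (ltnW ln)) (ltnW ln)) mE; rewrite mE ltnn in ml.
rewrite sum_card_set [in RHS]card_set_sum !big_distrl /=; apply: eq_bigr => z _.
have [Ez|nEz] := boolP (E (act_path f l z)).
  by rewrite eq_card0 // => u; rewrite inE actE.
by rewrite mul1n card_setC_mul // card_act.
Qed.

Lemma misses_prod i l : l <= n ->
  misses i l * \prod_(m < l.+1) c (iter m (@ordS n.+1) i) =
  #|{: R}| * #|Z i| * \prod_(m < l.+1) (c (iter m (@ordS n.+1) i)).-1.
Proof.
elim: l => [|l IH] ln; first by rewrite !big_ord1 misses0.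
rewrite big_ord_recr [in RHS]big_ord_recr /= mulnCA missesS // mulnA [_ * misses _ _]mulnC.
by rewrite IH ?mulnA // ltnW.
Qed.

Lemma prod_cycle (A : comSemiRingType) (F : 'I_n.+1 -> A) (i : 'I_n.+1) :
  (\prod_(m < n.+1) F (iter m (@ordS n.+1) i) = \prod_j F j)%R.
Proof.
rewrite [RHS](reindex_inj (h := fun m : 'I_n.+1 => iter m (@ordS n.+1) i)) //.
by move=> l m /iter_ordS_inj e; apply: val_inj; apply: e; rewrite -ltnS.
Qed.

(* Conditioning on all arrows but the one at [i]. *)
Lemma rep_probability i (P : pred R) :
    (forall f : R, #|[set u : M i | P (dffun_put f u)]| * #|Z (ordS i)| =
       #|M i| * #|[set z : Z (ordS i) | E (act_path f n z)]|) ->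
  (#|[set f | P f]|%:R / #|{: R}|%:R = 1 - \prod_j (1 - (c j)%:R^-1) :> rat)%R.
Proof.
move=> HP; pose i1 := ordS i.
(* By [HP], [P] is as likely as reaching [E] from a uniform point of [Z i1] along the other [n]
   arrows; [misses] counts the complement. *)
have NZ : #|[set f | P f]| * #|Z i1| + misses i1 n = #|{: R}| * #|Z i1|.
  have : #|[set f | P f]| * #|Z i1| =
      \sum_(f : R) #|[set z : Z i1 | E (act_path f n z)]|.
    apply/eqP; rewrite -(eqn_pmul2r (M_gt0 i)) mulnAC card_set_sum.
    rewrite -(sum_put (@dffun_get_put _ M i) (@dffun_put_get _ M i)).
    rewrite mulnC big_distrr big_distrl /=; apply/eqP/eq_bigr => f _.
    by rewrite -card_set_sum mulnC HP mulnC.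
  move=> ->; rewrite /misses -big_split -sum_nat_const; apply: eq_bigr => f _ /=.
  rewrite -(cardsC [set z : Z i1 | E (act_path f n z)]); congr (_ + _).
  by apply: eq_card => z; rewrite !inE.
have c_gt0 j : 0 < c j by have := Z_gt0 j; rewrite -card_E muln_gt0 => /andP[].
have R_gt0 : 0 < #|{: R}|.
  apply/card_gt0P; exists (finfun (fun j => xchoose (card_gt0P (M_gt0 j)))).
  by rewrite inE.
(* The starting point and the [n] arrows give one factor for each of the [n.+1] vertices. *)
have := misses_prod i1 (leqnn n).
rewrite (prod_cycle c) (prod_cycle (fun j => (c j).-1)).
set m := misses i1 n in NZ *; set N := #|_| in NZ *; set r := #|{: R}| in NZ R_gt0 *.
have := Z_gt0 i1; set a := #|Z i1| in NZ * => a_gt0 mis.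
have C_gt0 : 0 < \prod_j c j by rewrite prodn_gt0.
have -> : (\prod_j (1 - (c j)%:R^-1) = (\prod_j (c j).-1)%:R / (\prod_j c j)%:R :> rat)%R.
  rewrite !natr_prod -prodf_div; apply: eq_bigr => j _; have := c_gt0 j.
  case: (c j) => // d _ /=; have d0 : (d.+1%:R != 0 :> rat)%R by rewrite pnatr_eq0.
  have -> : (d%:R = d.+1%:R - 1 :> rat)%R by rewrite -addn1 natrD addrK.
  by rewrite mulrBl divff // mul1r.
have [r0 a0 C0] :
    [/\ (r%:R != 0 :> rat)%R, (a%:R != 0 :> rat)%R & ((\prod_j c j)%:R != 0 :> rat)%R].
  by split; rewrite pnatr_eq0 -lt0n.
have NZ' : (N%:R * a%:R + m%:R = r%:R * a%:R :> rat)%R by rewrite -!natrM -natrD NZ.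
have mis' : (m%:R * (\prod_j c j)%:R = r%:R * a%:R * (\prod_j (c j).-1)%:R :> rat)%R.
  by rewrite -!natrM mis.
have -> : (N%:R = (r%:R * a%:R - m%:R) / a%:R :> rat)%R by rewrite -NZ' addrK mulfK.
have -> : (m%:R = r%:R * a%:R * (\prod_j (c j).-1)%:R / (\prod_j c j)%:R :> rat)%R.
  by rewrite -mis' mulfK.
field; by rewrite r0 a0 C0.
Qed.

End CyclicPath.

(** * Eventual constancy read off from a first-return map *)

Lemma Tagged_inj (I : eqType) (X : I -> Type) i : injective (@Tagged I i X).
Proof. by move=> x y; apply: eq_from_Tagged. Qed.

Section EventuallyConstant.

Variables (n : nat) (X : 'I_n.+1 -> finType) (f : RepSet X).

Local Notation next := (@ordS n.+1).

(** A single self-map of the disjoint union, so that points over propositionally equal vertices can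
    be compared without transport. *)
Definition step (t : {i & X i}) : {i & X i} := Tagged X (f (tag t) (tagged t)).

Lemma iter_step i l (x : X i) : iter l step (Tagged X x) = Tagged X (set_path f l x).
Proof. by elim: l => //= l ->. Qed.

(** [g] is the composite of the [n] arrows from [ordS ord0] back to [ord0], so [h] is the
    first-return map at [ord0]; the orbit of its fixed point supplies the constants at all
    vertices. *)
Lemma eventually_constantP (g : X (ordS ord0) -> X ord0) :
    (forall y, Tagged X (g y) = Tagged X (set_path f n y)) ->
  eventually_constant f <-> exists r, collapses (fun x => g (f ord0 x)) r.
Proof.
move=> gE; pose h x := g (f ord0 x).
have turn x : iter n.+1 step (Tagged X x) = Tagged X (h x).
  by rewrite iterSr iter_step -gE.
have turns l x : iter (l * n.+1) step (Tagged X x) = Tagged X (iter l h x).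
  by elim: l => // l IH; rewrite mulSn iterD IH turn.
split=> [[c [L cL]]|[r [hr cr]]].
  have hL l x : L <= l -> iter l h x = c ord0.
    move=> Ll; apply: (@Tagged_inj _ X); rewrite -turns iter_step cL; last first.
      by rewrite (leq_trans Ll) // leq_pmulr.
    have -> // : iter (l * n.+1) next ord0 = ord0.
    by apply: ord_inj; rewrite val_iter_ordS modnMl.
  exists (c ord0); split; last by move=> x; exists L; apply: hL.
  by have := hL L.+1 (c ord0) (leqnSn L); rewrite iterS hL.
(* Finiteness turns the hitting times of single points into one bound; later iterates stay at the
   fixed point [r]. *)
have [L hL] : exists L, forall l x, L <= l -> iter l h x = r.
  have cr' x : exists l, iter l h x == r by have [l <-] := cr x; exists l.
  exists (\max_x ex_minn (cr' x)) => l x Ll.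
  have := leq_bigmax (F := fun x => ex_minn (cr' x)) x; case: ex_minnP => m /eqP mr _ mL.
  by rewrite -(subnK (leq_trans mL Ll)) iterD mr iter_fixpoint.
have tag_iter l i (x : X i) : tag (iter l step (Tagged X x)) = iter l next i.
  by rewrite iter_step.
have tag_r i : tag (iter (i : 'I_n.+1) step (Tagged X r)) = i.
  by rewrite tag_iter; apply: ord_inj; rewrite val_iter_ordS /= add0n modn_small.
pose c i := etagged (tag_r i).
have orbit_r m : iter m step (Tagged X r) = Tagged X (c (iter m next ord0)).
  rewrite etaggedK val_iter_ordS /= add0n {1}(divn_eq m n.+1) addnC iterD turns.
  by rewrite (iter_fixpoint _ (hr : h r = r)).
(* At most [n.+1] steps lead to vertex [ord0], and [L] full turns then lead to [r]. *)
exists c, (L * n.+1 + n.+1) => l Ll i x; apply: (@Tagged_inj _ X).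
rewrite -iter_step -(tag_iter l i x).
suff [j ->] : exists j, iter l step (Tagged X x) = Tagged X (c j) by [].
have tag0 : tag (iter (n.+1 - i) step (Tagged X x)) = ord0.
  rewrite tag_iter; apply: ord_inj; rewrite val_iter_ordS subnKC ?modnn //.
  exact: ltnW.
have le : L * n.+1 + (n.+1 - i) <= l by apply: leq_trans Ll; rewrite leq_add2l leq_subr.
rewrite -(subnK le) 2!iterD -(etaggedK tag0) turns hL // orbit_r.
by eexists.
Qed.

End EventuallyConstant.
Local Open Scope ring_scope.

(** * One random linear arrow *)

Section LinearMaps.

Variables (F : finFieldType) (V W : vectType F).

(** For [x] outside [U], a functional vanishing on [U] with value 1 at [x]: the coordinate along the
    residue of [x] modulo [U]. *)
Definition lin_sep (U : {vspace V}) (x : V) : 'Hom(V, F^o) :=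
  (linfun (coord [tuple x - projv U x] ord0 : V -> F^o) \o (\1 - projv U))%VF.

Lemma lin_sep0 (U : {vspace V}) x y : y \in U -> lin_sep U x y = 0.
Proof.
move=> yU; rewrite /lin_sep comp_lfunE add_lfunE opp_lfunE id_lfunE (projv_id yU) subrr.
exact: linear0.
Qed.

Lemma lin_sep1 (U : {vspace V}) x : x \notin U -> lin_sep U x x = 1.
Proof.
move=> xU; rewrite /lin_sep comp_lfunE add_lfunE opp_lfunE id_lfunE lfunE /=.
have fr : free [tuple x - projv U x].
  by rewrite seq1_free subr_eq0; apply: contraNneq xU => ->; exact: memv_proj.
exact: (coord_free ord0 ord0 fr).
Qed.

Definition scale_by (w : W) (a : F^o) : W := (a : F) *: w.

Fact scale_by_linear (w : W) : linear (scale_by w).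
Proof. by move=> c a b; rewrite /scale_by scalerDl scalerA. Qed.
HB.instance Definition _ (w : W) :=
  GRing.isLinear.Build F F^o W *:%R (scale_by w) (scale_by_linear w).

(** A rank-one correction that moves the value at [x] to [w] and leaves [f] unchanged on [U], for
    [x] outside [U]. *)
Definition lin_put (U : {vspace V}) (x : V) (f : 'Hom(V, W)) (w : W) : 'Hom(V, W) :=
  f + (linfun (scale_by (w - f x)) \o lin_sep U x)%VF.

Lemma lin_putE U x f w y : lin_put U x f w y = f y + (lin_sep U x y : F) *: (w - f x).
Proof. by rewrite /lin_put add_lfunE comp_lfunE lfunE. Qed.

Lemma lin_put_out (U : {vspace V}) x f w y : y \in U -> lin_put U x f w y = f y.
Proof. by move=> yU; rewrite lin_putE lin_sep0 // scale0r addr0. Qed.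

Lemma lin_get_put (U : {vspace V}) x f w : x \notin U -> lin_put U x f w x = w.
Proof. by move=> xU; rewrite lin_putE lin_sep1 // scale1r addrC subrK. Qed.

Lemma lin_put_get (U : {vspace V}) x f w : x \notin U ->
  lin_put U x (lin_put U x f w) (f x) = f.
Proof.
move=> xU; apply/lfunP => y; rewrite !lin_putE lin_sep1 // scale1r.
have -> : f x + (w - f x) = w by rewrite addrC subrK.
by rewrite -addrA -scalerDr -(opprB w) subrr scaler0 addr0.
Qed.

Definition lin_closed (C : {set finvect_type V}) : bool :=
  (0 \in C) && [forall a : F, forall u in C, forall v in C, a *: u + v \in C].

Lemma lin_closedP (C : {set finvect_type V}) :
  reflect (0 \in C /\ forall (a : F) u v, u \in C -> v \in C -> a *: u + v \in C)
          (lin_closed C).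
Proof.
apply: (iffP andP) => -[C0 CZ]; split=> //.
  by move=> a u v uC vC; move/forallP/(_ a)/forall_inP/(_ u uC)/forall_inP: CZ; apply.
by apply/forallP => a; apply/forall_inP => u uC; apply/forall_inP => v; apply: CZ.
Qed.

Lemma lin_closed_vspace (C : {set finvect_type V}) : lin_closed C ->
  exists U : {vspace V}, forall x : V, (x \in U) = (x \in C).
Proof.
move=> /lin_closedP[C0 CZ]; exists <<(enum C : seq V)>>%VS => x; apply/idP/idP => [|xC].
  move=> /(coord_span (X := in_tuple (enum C : seq V)))->.
  apply: (big_ind (fun x : finvect_type V => x \in C)) => // [u v uC vC|i _].
    by rewrite -[u]scale1r CZ.
  rewrite -[X in X \in C]addr0 CZ // -mem_enum; exact: mem_nth.
have : (x : finvect_type V) \in enum C by rewrite mem_enum.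
by move=> H; exact (@memv_span F V (enum C) x H).
Qed.

Variable g : 'Hom(W, V).

Let ev (f : finvect_type 'Hom(V, W)) (x : finvect_type V) : finvect_type W :=
  (f : 'Hom(V, W)) x.
Let gg (w : finvect_type W) : finvect_type V := g w.

Lemma hopZD f (a : F) (u v : V) : hop ev gg f (a *: u + v) = a *: hop ev gg f u + hop ev gg f v.
Proof. by rewrite /hop /ev /gg !linearP. Qed.

Lemma iter_hopZD f (a : F) (u v : V) l :
  iter l (hop ev gg f) (a *: u + v) = a *: iter l (hop ev gg f) u + iter l (hop ev gg f) v.
Proof. by elim: l => //= l ->; rewrite hopZD. Qed.

Lemma hop0 f : hop ev gg f 0 = 0.
Proof. by rewrite /hop /ev /gg !linear0. Qed.

Lemma iter_hop0 f l : iter l (hop ev gg f) 0 = 0.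
Proof. exact/iter_fixpoint/hop0. Qed.

Lemma iter_hop_sum f l (I : finType) (c : I -> F) (y : I -> V) :
  iter l (hop ev gg f) (\sum_i c i *: y i) = \sum_i c i *: iter l (hop ev gg f) (y i).
Proof.
by elim/big_rec2: _ => [|i y1 y2 _ <-]; [apply: iter_hop0 | apply: iter_hopZD].
Qed.

Lemma attracts0D f (a : F) u v : attracts ev gg [set 0] f u -> attracts ev gg [set 0] f v ->
  attracts ev gg [set 0] f (a *: u + v).
Proof.
move=> [l lu] [m mv]; exists (l + m)%N; rewrite iter_hopZD inE.
move: lu mv; rewrite !inE => /eqP lu /eqP mv.
by rewrite {1}addnC !iterD lu mv !iter_hop0 scaler0 addr0.
Qed.

(* If [h^j v = a + \sum_(i < j) c_i h^i v] with [a \in A] and [i] is the least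
   index with [c_i != 0], applying [h^(N - 1 - i)], where [N] is the first
   entrance time of the orbit into [A], puts [h^(N - 1) v] in [A]. *)
Lemma lin_hull_return f (A : {set finvect_type V}) v j :
    lin_closed A -> {in A, forall x, hop ev gg f x \in A} ->
    attracts ev gg A f v ->
    iter j (hop ev gg f) v \in orbit_hull ev gg lin_closed f A v j ->
  iter j (hop ev gg f) v \in A.
Proof.
move=> /lin_closedP[A0 AZ] stA att; set h := hop ev gg f.
have AD (x y : V) : x \in A -> y \in A -> x + y \in A.
  by move=> xA yA; rewrite -[x]scale1r AZ.
have AM (a : F) (x : V) : x \in A -> a *: x \in A.
  by move=> xA; rewrite -[_ *: _]addr0 AZ.
have AN (x : V) : x \in A -> - x \in A by move=> xA; rewrite -scaleN1r AM.
pose comb (c : {ffun 'I_j -> F}) : V := \sum_i c i *: iter i h v.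
(* [D] is [A] plus the span of the orbit before time [j], with explicit coefficients; being closed,
   it contains the hull. *)
pose D : {set finvect_type V} :=
  [set x : finvect_type V | [exists c, (x : V) - comb c \in A]].
have inD (x : finvect_type V) : reflect (exists c, x - comb c \in A) (x \in D).
  by rewrite inE; apply: existsP.
have subD : orbit_hull ev gg lin_closed f A v j \subset D.
  apply: orbit_hull_min.
  - apply/lin_closedP; split=> [|a x y /inD[c cx] /inD[d dy]].
      apply/inD; exists [ffun=> 0]; rewrite sub0r AN // /comb big1 // => i _.
      by rewrite ffunE scale0r.
    apply/inD; exists [ffun i => a * c i + d i].
    have -> : comb [ffun i => a * c i + d i] = a *: comb c + comb d.
      rewrite /comb scaler_sumr -big_split; apply: eq_bigr => i _.
      by rewrite ffunE scalerDl scalerA.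
    by rewrite opprD addrACA -scalerBr AZ.
  - apply/subsetP => x xA; apply/inD; exists [ffun=> 0].
    rewrite /comb big1 ?subr0 // => i _; by rewrite ffunE scale0r.
  - move=> i ij; apply/inD; exists [ffun k => (k == Ordinal ij)%:R].
    rewrite /comb (bigD1 (Ordinal ij)) //= ffunE eqxx scale1r big1 ?addr0 ?subrr //.
    by move=> k /negbTE nk; rewrite ffunE nk scale0r.
move=> /(subsetP subD)/inD[c cA].
have stI l x : x \in A -> iter l h x \in A by move=> xA; apply: iter_stable.
have [N NA minN] := ex_minnP (P := fun l => iter l h v \in A) att.
have after l : (N <= l)%N -> iter l h v \in A.
  by move=> Nl; rewrite -(subnK Nl) iterD stI.
have [/after//|jN] := leqP N j.
have [i1 ci1|c0] := pickP (fun i => c i != 0); last first.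
  move: cA; rewrite /comb big1 ?subr0 // => i _.
  by move/negbFE/eqP: (c0 i) => ->; rewrite scale0r.
have [i ci minc] := @arg_minnP _ i1 (fun i => c i != 0) (@nat_of_ord j) ci1.
pose d := (N - i.+1)%N; have ij := ltn_ord i.
have := stI d _ cA; rewrite -[_ - _]addrC -scaleN1r iter_hopZD iter_hop_sum scaleN1r.
rewrite (bigD1 i) //= opprD => H.
(* By minimality of [i], any other nonzero coefficient has [k > i], hence [d + k >= N]. *)
have rest : \sum_(k < j | k != i) c k *: iter d h (iter k h v) \in A.
  apply: (big_ind (fun x : V => x \in A)) => // k ki.
  have [->|ck] := eqVneq (c k) 0; first by rewrite scale0r.
  rewrite AM // -iterD after // /d; have := minc k ck; have := ki.
  rewrite -val_eqE /=; lia.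
have vj : iter d h (iter j h v) \in A by rewrite -iterD after // /d; lia.
have : c i *: iter N.-1 h v \in A.
  have -> : iter N.-1 h v = iter d h (iter i h v).
    by rewrite -iterD; congr (iter _ _ _); rewrite /d; lia.
  set y := c i *: _ in H *; set r := \sum_(k < j | _) _ in H rest.
  have -> : y = - (- y - r + iter d h (iter j h v)) + (iter d h (iter j h v) - r).
    by rewrite !opprD !opprK addrA subrK addrK.
  by rewrite AD ?AN // AD ?AN.
move/(AM (c i)^-1); rewrite scalerA mulVf // scale1r => /minN; lia.
Qed.

(** All linear maps fix 0 and agree with the zero map on [[set 0]], so [card_nil_agree] applies
    without conditioning: one factor, where arbitrary maps give two. *)
Lemma card_collapsing_lin :
  (#|[set f : finvect_type 'Hom(V, W) |
       `[< exists r, collapses (fun x : V => g ((f : 'Hom(V, W)) x)) r >]]|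
    * #|finvect_type W| =
  #|finvect_type 'Hom(V, W)| * #|[set w : finvect_type W | g w == 0%R]|)%N.
Proof.
have closed0 : lin_closed ([set 0] : {set finvect_type V}).
  apply/lin_closedP; split=> [|a u w]; rewrite !inE // => /eqP-> /eqP->.
  by rewrite scaler0 addr0.
have tr f : trap ev gg lin_closed [set 0] [set 0] f.
  split=> // [x|]; first by rewrite !inE => /eqP->; rewrite (hop0 f).
  by apply/subsetP => x x0; rewrite inE; apply/asboolP; exists 0%N.
have agreeE f : f \in agree ev [set 0] 0.
  by rewrite inE; apply/forall_inP => x; rewrite inE => /eqP->; rewrite /ev !linear0.
have -> : #|finvect_type 'Hom(V, W)| = #|agree ev [set 0] 0|.
  by apply: eq_card => f; rewrite agreeE.
have -> : #|[set w : finvect_type W | g w == 0%R]| = #|[set w | gg w \in [set 0]]|.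
  by apply: eq_card => w; rewrite !inE.
rewrite -(card_nil_agree (closed := lin_closed) (A0 := [set 0])) //.
- congr (_ * _)%N; apply: eq_card => f; rewrite in_set [RHS]in_set agreeE /=.
  apply/asboolP/asboolP => [[r [hr cr]] x|nf].
    have r0 : r = 0 by have [l <-] := cr 0; apply: (iter_hop0 f).
    by have [l lx] := cr x; exists l; rewrite inE -r0; apply/eqP.
  exists 0; split; first exact: (hop0 f).
  by move=> x; have [l] := nf x; rewrite inE => /eqP; exists l.
- by apply/lin_closedP; split=> *; rewrite inE.
- move=> C D /lin_closedP[C0 CZ] /lin_closedP[D0 DZ]; apply/lin_closedP; split.
    by rewrite inE C0.
  by move=> a u w /setIP[uC uD] /setIP[wC wD]; rewrite inE CZ // DZ.
- move=> f f'; apply/lin_closedP; split; first by rewrite inE /ev !linear0.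
  move=> a u w; rewrite !inE => /eqP fu /eqP fw; apply/eqP; rewrite /ev !linearP.
  by congr (_ *: _ + _).
- move=> f C /lin_closedP[C0 CZ]; apply/lin_closedP; split.
    by rewrite inE (hop0 f).
  by move=> a u w; rewrite !inE hopZD; apply: CZ.
- move=> f; apply/lin_closedP; split.
    by rewrite inE; apply/asboolP; exists 0%N; rewrite inE.
  move=> a u w; rewrite !inE => /asboolP au /asboolP aw; apply/asboolP.
  exact: attracts0D.
- move=> B x cB; have [U UB] := lin_closed_vspace cB; rewrite -UB => xU.
  exists (lin_put U x); split=> [f w y|f w|f w].
  + by rewrite -UB => yU; apply: lin_put_out.
  + exact: lin_get_put.
  + exact: lin_put_get.
- move=> f A v j cA sA0 stA nf; apply: lin_hull_return => //.
  by have [l hl] := nf v; exists l; apply: (subsetP sA0).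
Qed.

End LinearMaps.

(** * One-step collapse counts *)

(** Resampling [u a] leaves [u b] alone, and exactly one new value merges the two. *)
Lemma card_ffun_merge (X Y : finType) (a b : X) : a != b ->
  (#|[set u : {ffun X -> Y} | u a == u b]| * #|Y| = #|{ffun X -> Y}|)%N.
Proof.
move=> ab; have ba : b != a by rewrite eq_sym.
rewrite card_set_sum -(sum_put (@ffun_get_put X Y a) (@ffun_put_get X Y a)).
rewrite -sum1_card; apply: eq_bigr => u _.
rewrite (bigD1 (u b)) //= ffun_get_put (ffun_put_out _ _ ba) eqxx big1 // => y /negbTE yb.
by rewrite ffun_get_put (ffun_put_out _ _ ba) yb.
Qed.

Lemma card_diag (X : finType) : #|[set z : X * X | z.1 == z.2]| = #|X|.
Proof.
rewrite -(card_imset (f := fun x : X => (x, x))) => [|x y [] //]; apply: eq_card => -[x y].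
by rewrite inE /=; apply/eqP/imsetP => [->|[z _ [-> ->]] //]; exists y.
Qed.

(** As [v] is outside the zero subspace, [lin_put] resamples [u v], which is therefore uniform on
    [W]. *)
Lemma card_hom_kill (F : finFieldType) (V W : vectType F) (v : V) : v != 0 ->
  (#|[set u : finvect_type 'Hom(V, W) | (u : 'Hom(V, W)) v == 0%R]| * #|finvect_type W| =
   #|finvect_type 'Hom(V, W)|)%N.
Proof.
move=> v0; have v0' : v \notin 0%VS by rewrite memv0.
rewrite (@card_get (finvect_type 'Hom(V, W)) (finvect_type W)
  (fun u => (u : 'Hom(V, W)) v) (lin_put 0%VS v) _ _ (pred1 0)).
- rewrite (_ : [set _ | _] = [set 0]) ?cards1 ?muln1 //.
  by apply/setP => w; rewrite !inE.
- by move=> u w; apply: lin_get_put.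
- by move=> u w; apply: lin_put_get.
Qed.

Lemma card_finvect (F : finFieldType) (V : vectType F) :
  #|finvect_type V| = (#|F| ^ \dim {:V})%N.
Proof.
by rewrite -(card_vspacef (Vector.class (finvect_type V))) card_vspace.
Qed.

Lemma iter_ordS_neq0 n m : (m < n)%N -> iter m (@ordS n.+1) (ordS ord0) != ord0.
Proof.
move=> mn; rewrite -iterSr; apply/eqP => /(congr1 (@nat_of_ord _)).
by rewrite val_iter_ordS modn_small.
Qed.

(** * Probability of eventual constancy *)

Section SetSide.

Variables (n : nat) (X : 'I_n.+1 -> finType).

Let Z i : finType := (X i * X i)%type.
Let M i : finType := {ffun X i -> X (ordS i)}.
Let act i (u : M i) (z : Z i) : Z (ordS i) := (u z.1, u z.2).

Lemma set_path_pair (f : RepSet X) i l (z : Z i) :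
  act_path (M := M) act f l z = (set_path f l z.1, set_path f l z.2).
Proof. by elim: l => [|l /= ->] //; case: z. Qed.

(** A full turn ends at [ord0] only up to propositional equality; this gives the composite its
    proper codomain. *)
Lemma set_return (S : Type) (j j' : 'I_n.+1) (h : S -> X j) : j = j' ->
  exists g : S -> X j', forall y, Tagged X (g y) = Tagged X (h y).
Proof. by case: j' /; exists h. Qed.

Lemma set_path_put (f : RepSet X) (u : M ord0) (y : X (ordS ord0)) :
  set_path (dffun_put f u : RepSet X) n y = set_path f n y.
Proof.
have := set_path_pair (dffun_put f u) n (y, y).
by rewrite act_path_put => [|m /iter_ordS_neq0 //]; rewrite set_path_pair => -[].
Qed.

(** The states are pairs of points moved by the same maps. With the other arrows fixed,
    [card_collapsing_ffun] equates collapse with the merging of a uniform pair under their composite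
    [g]. *)
Lemma EC_probability : (forall i, 0 < #|X i|)%N ->
  (#|EC X|%:R / #|RepSet X|%:R : rat) = 1 - \prod_i (1 - #|X i|%:R^-1).
Proof.
move=> X_gt0.
rewrite (@rep_probability n Z M act (fun i z => z.1 == z.2) (fun i => #|X i|)
  _ _ _ _ _ ord0 (fun f => `[< eventually_constant (f : RepSet X) >])) //.
- by move=> i u z /eqP e; apply/eqP; rewrite /= e.
- by move=> i [a b] ab; apply: card_ffun_merge.
- by move=> i; rewrite card_diag card_prod.
- by move=> i; rewrite card_ffun expn_gt0 X_gt0.
- by move=> i; rewrite card_prod muln_gt0 X_gt0.
move=> f.
have [g gE] := set_return (@set_path _ X f (ordS ord0) n) (iter_ordS_cycle ord0).
have := card_collapsing_ffun g; rewrite card_prod -mulnn => H.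
rewrite (_ : [set u : M ord0 | _] =
  [set u : M ord0 | `[< exists r, collapses (fun x => g (u x)) r >]]).
  rewrite H; congr (_ * _)%N; apply: eq_card => -[a b]; rewrite !inE set_path_pair /=.
  apply/eqP/eqP => e; apply: (@Tagged_inj _ X); first by rewrite -!gE e.
  by rewrite !gE; congr (Tagged X _).
apply/setP => u; rewrite !inE; apply: asbool_equiv_eq.
rewrite (@eventually_constantP n X (dffun_put f u) g).
  by rewrite dffun_get_put.
by move=> y; rewrite gE set_path_put.
Qed.

End SetSide.

(** * Probability of nilpotency *)

Section LinearSide.

Variables (n : nat) (F : finFieldType) (V : 'I_n.+1 -> vectType F).

Let Z i : finType := finvect_type (V i).
Let M i : finType := finvect_type 'Hom(V i, V (ordS i)).
Let act i (u : M i) (z : Z i) : Z (ordS i) := (u : 'Hom(V i, V (ordS i))) z.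

Definition set_rep (f : Rep V) : RepSet Z := [ffun i => [ffun x => act (f i) x]].

Lemma set_rep_path f i l (z : Z i) : set_path (set_rep f) l z = lin_path f i l z.
Proof.
by elim: l => [|l IH] /=; rewrite ?id_lfunE // IH /set_rep !ffunE /act comp_lfunE.
Qed.

Lemma lin_act_path f i l (z : Z i) : act_path (M := M) act f l z = lin_path f i l z.
Proof. by elim: l => [|l /= ->]; rewrite ?id_lfunE // comp_lfunE. Qed.

(** A linear composite with only one value has the value 0, the image of the zero vector. *)
Lemma nilpotent_repE f : nilpotent_rep f <-> eventually_constant (set_rep f).
Proof.
split=> [nil|[c [L cL]] i].
  exists (fun i => 0); pose L i := projT1 (cid (nil i)).
  exists (\max_i L i)%N => l Ll i x; rewrite set_rep_path /L.
  rewrite (projT2 (cid (nil i)) l) ?zero_lfunE //.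
  exact: leq_trans (leq_bigmax i) Ll.
exists L => l Ll; apply/lfunP => x; rewrite zero_lfunE -set_rep_path (cL l Ll i x).
by rewrite -(cL l Ll i 0) set_rep_path linear0.
Qed.

(** As in [set_return]; the kernel is recorded separately because the zero vectors over [j] and [j']
    have different types. *)
Lemma lin_return (i j j' : 'I_n.+1) (L : 'Hom(V i, V j)) : j = j' ->
  exists g : 'Hom(V i, V j'), forall y,
    Tagged Z (g y : Z j') = Tagged Z (L y : Z j) /\ (g y == 0) = (L y == 0).
Proof. by case: j' /; exists L. Qed.

Lemma lin_path_put (f : Rep V) (u : M ord0) (y : V (ordS ord0)) :
  lin_path (dffun_put f u : Rep V) (ordS ord0) n y = lin_path f (ordS ord0) n y.
Proof. by rewrite -!lin_act_path act_path_put // => m /iter_ordS_neq0. Qed.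

(** The states are single vectors, and [c i] is [#|Z i|] because exactly one vector is zero. *)
Lemma nilpotent_probability :
  (#|NilRep V|%:R / #|Rep V|%:R : rat) = 1 - \prod_i (1 - #|Z i|%:R^-1).
Proof.
have gt0 (U : vectType F) : (0 < #|finvect_type U|)%N by apply/card_gt0P; exists 0.
rewrite (@rep_probability n Z M act (fun i z => z == 0) (fun i => #|Z i|)
  _ _ _ _ _ ord0 (fun f => `[< nilpotent_rep (f : Rep V) >])) //.
- by move=> i u z /eqP->; rewrite /act linear0.
- by move=> i z z0; apply: card_hom_kill.
- move=> i; rewrite (_ : [set _ | _] = [set 0]) ?cards1 ?mul1n //.
  by apply/setP => z; rewrite !inE.
- by move=> i; apply: gt0.
- by move=> i; apply: gt0.
move=> f; have [g gE] := lin_return (lin_path f (ordS ord0) n) (iter_ordS_cycle ord0).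
have := card_collapsing_lin g => H.
rewrite (_ : [set u : M ord0 | _] = [set u : M ord0 | `[< exists r,
    collapses (fun x : V ord0 => g ((u : 'Hom(V ord0, V (ordS ord0))) x)) r >]]).
  rewrite H; congr (_ * _)%N; apply: eq_card => z; rewrite !inE lin_act_path.
  by rewrite (gE z).2.
apply/setP => u; rewrite !inE; apply: asbool_equiv_eq; rewrite nilpotent_repE.
rewrite (@eventually_constantP n Z (set_rep (dffun_put f u)) g) => [|y].
  have -> // : (fun x => g (set_rep (dffun_put f u) ord0 x)) =
    (fun x => g ((u : 'Hom(V ord0, V (ordS ord0))) x)).
  by apply/funext => x; rewrite /set_rep !ffunE dfwith_in.
by rewrite (gE y).1 set_rep_path lin_path_put.
Qed.

End LinearSide.

(** * Both probabilities in terms of [q] and [beta] *)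

Theorem proposition5p2 (k : nat) (hk : (2 <= k)%N)
    (q : nat) (F : finFieldType) (hF : #|F| = q)
    (beta : 'I_k -> nat)
    (V : 'I_k -> vectType F) (hV : forall i : 'I_k, \dim {:V i} = beta i)
    (X : 'I_k -> finType) (hX : forall i : 'I_k, #|X i| = (q ^ beta i)%N) :
  (#|NilRep V|%:R / #|Rep V|%:R : rat)
    = 1 - \prod_(i < k) (1 - (q%:R : rat) ^- beta i)
  /\
  1 - \prod_(i < k) (1 - (q%:R : rat) ^- beta i)
    = (#|EC X|%:R / #|RepSet X|%:R : rat).
Proof.
case: k hk beta V hV X hX => // n _ beta V hV X hX; split.
  rewrite nilpotent_probability; congr (1 - _); apply: eq_bigr => i _.
  by rewrite card_finvect hV hF natrX.
rewrite EC_probability => [|i]; last by rewrite hX expn_gt0 -hF (ltnW (finNzRing_gt1 F)).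
by congr (1 - _); apply: eq_bigr => i _; rewrite hX natrX.
Qed.
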